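(* Let $\Gamma$ be the graph of the dodecahedron, let $G$ be the group of automorphisms of $\Gamma$ corresponding to rotational symmetries of the dodecahedron, and let $\mathcal{B}$ be the partition of $V\Gamma$ into antipodal pairs of vertices. Identify the quotient graph $\Gamma_{\mathcal{B}}$ with the labelled Petersen graph $\Delta$, and the group $G^{\mathcal{B}}$ with $A_5$ acting on $V\Delta$. For each $a\in\{1,\ldots,5\}$ let $Q_a$ be the set of edges $\{\{b,c\},\{d,e\}\}$ of $\Delta$ such that $a\notin\{b,c,d,e\}$, and let $$P_a=\{\{\alpha,\beta\}\in E\Gamma\mid \text{there is } \{B_i,B_j\}\in Q_a \text{ with } \alpha\in B_i \text{ and } \beta\in B_j\}.$$ Let $\mathcal{P}=\{P_a\mid a\in\{1,\ldots,5\}\}$. Then $(\Gamma,\mathcal{P})$ is a $G$-transitive $1$-decomposition.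
   Context: Graphs are simple and undirected; $V\Gamma$ and $E\Gamma$ denote the vertex set and edge set of $\Gamma$, an edge being an unordered pair of distinct vertices. For a graph $\Gamma$, a group $G$ of automorphisms of $\Gamma$ and a partition $\mathcal{P}$ of $E\Gamma$ (into nonempty parts), the pair $(\Gamma,\mathcal{P})$ is called a $G$-transitive decomposition if (1) for every $P\in\mathcal{P}$ and $g\in G$, the image $P^g$ is again a part in $\mathcal{P}$ (possibly $P$ itself), and (2) for all $P,P'\in\mathcal{P}$ there exists $g\in G$ with $P^g=P'$. It is a $G$-transitive $1$-decomposition if in addition, for each $P\in\mathcal{P}$, the subgraph with edge set $P$ and vertex set the vertices of $\Gamma$ incident with edges in $P$ has valency $1$, i.e. no two distinct edges in $P$ share a vertex. The partition $\mathcal{B}$ of $V\Gamma$ into antipodal pairs is $G$-invariant; $G^{\mathcal{B}}$ denotes the group of permutations of $\mathcal{B}$ induced by $G$. The imprimitive quotient $\Gamma_{\mathcal{B}}$ is the graph with vertex set $\mathcal{B}$ in which distinct $B_1,B_2\in\mathcal{B}$ form an edge whenever there exist $\alpha\in B_1$ and $\beta\in B_2$ with $\{\alpha,\beta\}\in E\Gamma$. $\Delta$ is the Petersen graph with vertices labelled by the unordered pairs of distinct elements of $\{1,2,3,4,5\}$, where $\{a,b\}$ is adjacent to $\{c,d\}$ whenever $\{a,b\}\cap\{c,d\}=\varnothing$. The alternating group $A_5$ acts on $\Delta$ as a group of automorphisms by $\{a,b\}^g=\{a^g,b^g\}$. It is well known that $\Gamma_{\mathcal{B}}$ is isomorphic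 to $\Delta$ by an isomorphism carrying the permutation group $G^{\mathcal{B}}$ to this action of $A_5$; the identification in the claim is by such an isomorphism. *)

(* Defs.v *)
(* MathComp, with the real numbers as an arbitrary [R : realType]. *)
From HB Require Import structures.
From mathcomp Require Import all_boot all_order all_algebra.
From mathcomp Require Import all_fingroup all_solvable.
From mathcomp Require Import boolp reals.

Set Implicit Arguments.
Unset Strict Implicit.
Unset Printing Implicit Defensive.

Import Order.TTheory GRing.Theory Num.Theory.

Local Open Scope ring_scope.

(* The vertex set is a subset of a finite type, so that a quotient graph can
   have a set of subsets as its vertex set. *)
Record graph (T : finType) := Graph {
  vset : {set T};
  eset : {set {set T}};
  eset_pairs : forall e, e \in eset -> (e \subset vset) && (#|e| == 2%N)
}.

Section Graphs.
Variable T : finType.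
Implicit Types (Gamma : graph T) (E : {set {set T}}) (g : {perm T}).

Definition edges_image g E : {set {set T}} := [set g @: e | e : {set T} in E].

(* A permutation of the vertex set is a permutation of [T] that is the identity
   outside [vset Gamma]. *)
Definition graph_auts Gamma : {set {perm T}} :=
  [set g | perm_on (vset Gamma) g &
           edges_image g (eset Gamma) == eset Gamma].

Definition valency E (v : T) : nat := #|[set e in E | v \in e]|.

Definition transitive_decomposition Gamma (G : {group {perm T}})
    (P : {set {set {set T}}}) : Prop :=
  [/\ G \subset graph_auts Gamma,
      partition P (eset Gamma),
      (forall X g, X \in P -> g \in G -> edges_image g X \in P)
    & (forall X Y, X \in P -> Y \in P ->
         exists2 g, g \in G & edges_image g X = Y)].

(* [cover X] is the set of vertices incident with an edge in [X]. *)
Definition transitive_1_decomposition Gamma (G : {group {perm T}})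
    (P : {set {set {set T}}}) : Prop :=
  transitive_decomposition Gamma G P /\
  forall X, X \in P -> {in cover X, forall v, valency X v = 1%N}.

Definition quotient_eset Gamma (B : {set {set T}}) : {set {set {set T}}} :=
  [set [set B1; B2] | B1 in B, B2 in B &
     (B1 != B2) &&
     [exists x in B1, exists y in B2, [set x; y] \in eset Gamma]].

Lemma quotient_eset_pairs Gamma (B : {set {set T}}) e :
  e \in quotient_eset Gamma B -> (e \subset B) && (#|e| == 2%N).
Proof.
case/imset2P=> B1 B2 B1B; rewrite inE => /andP[B2B /andP[neq _]] ->.
by rewrite cards2 neq subUset !sub1set B1B B2B.
Qed.

Definition quotient_graph Gamma (B : {set {set T}}) : graph {set T} :=
  @Graph {set T} B (quotient_eset Gamma B) (@quotient_eset_pairs Gamma B).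

(* The permutations of a [G]-invariant family [S] of subsets of [T] induced by
   the elements of [G], each extended by the identity outside [S]. *)
Definition induced_perms (G : {set {perm T}}) (S : {set {set T}}) :
    {set {perm {set T}}} :=
  [set restr_perm S (actperm ('P^*)%act g) | g in G].

End Graphs.

Definition graph_iso (T U : finType) (Gamma : graph T) (Delta : graph U)
    (f : T -> U) : Prop :=
  [/\ {in vset Gamma &, injective f},
      f @: vset Gamma = vset Delta
    & {in vset Gamma &, forall x y,
        ([set f x; f y] \in eset Delta) = ([set x; y] \in eset Gamma)}].

(* [f] carries the permutation group [H] on [A] to the permutation group [K]
   on [f @: A]. *)
Definition carries_perms (T U : finType) (f : T -> U) (A : {set T})
    (H : {set {perm T}}) (K : {set {perm U}}) : Prop :=
  (forall h, h \in H -> exists2 k, k \in K & {in A, forall x, f (h x) = k (f x)})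
  /\
  (forall k, k \in K -> exists2 h, h \in H & {in A, forall x, f (h x) = k (f x)}).

(* The labels 1, ..., 5 are represented by the elements 0, ..., 4 of ['I_5]. *)
Definition petersen_vset : {set {set 'I_5}} := [set v : {set 'I_5} | #|v| == 2%N].

Definition petersen_eset : {set {set {set 'I_5}}} :=
  [set [set v; w] | v in petersen_vset, w in petersen_vset & v :&: w == set0].

Lemma petersen_eset_pairs e :
  e \in petersen_eset -> (e \subset petersen_vset) && (#|e| == 2%N).
Proof.
case/imset2P=> v w vP; rewrite inE => /andP[wP /eqP vw0] ->.
rewrite cards2 subUset !sub1set vP wP /=.
case: (eqVneq v w) vw0 => [-> | //]; rewrite setIid => w0.
by move: wP; rewrite inE w0 cards0.
Qed.

Definition petersen : graph {set 'I_5} := Graph petersen_eset_pairs.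

Definition petersen_A5 : {set {perm {set 'I_5}}} :=
  induced_perms ('Alt_('I_5))%g petersen_vset.

(* The edges {{b,c},{d,e}} of the Petersen graph with a not in {b,c,d,e}. *)
Definition Q_ (a : 'I_5) : {set {set {set 'I_5}}} :=
  [set e in eset petersen | a \notin cover e].

Section Dodecahedron.
Variable R : realType.

Definition golden : R := (1 + Num.sqrt 5) / 2.

Definition pt (x y z : R) : 'rV[R]_3 := \row_(j < 3) [:: x; y; z]`_j.

Definition pm (a : R) : seq R := [:: a; - a].

(* The regular dodecahedron centred at the origin and circumscribed about the
   cube with vertices (+-1, +-1, +-1). *)
Definition dodecahedron_points : seq 'rV[R]_3 :=
  [seq pt p.1 p.2 z | p <- [seq (x, y) | x <- pm 1, y <- pm 1], z <- pm 1]
  ++ [seq pt 0 y z | y <- pm golden^-1, z <- pm golden]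
  ++ [seq pt x y 0 | x <- pm golden^-1, y <- pm golden]
  ++ [seq pt x 0 z | x <- pm golden, z <- pm golden^-1].

Definition dvertex : finType := seq_sub dodecahedron_points.

Definition dot (u v : 'rV[R]_3) : R := (u *m v^T) 0 0.

(* [F] is the vertex set of a face of the polytope spanned by the vertices,
   i.e. of its intersection with a supporting plane {x | dot c x = d}. *)
Definition is_face (F : {set dvertex}) : Prop :=
  exists (c : 'rV[R]_3) (d : R), forall v : dvertex,
    dot c (val v) <= d /\ (v \in F <-> dot c (val v) = d).

(* The edges of the polytope are its faces with exactly two vertices. *)
Definition dodecahedron_eset : {set {set dvertex}} :=
  [set e : {set dvertex} | (#|e| == 2%N) && `[< is_face e >]].

Lemma dodecahedron_eset_pairs e :
  e \in dodecahedron_eset -> (e \subset [set: dvertex]) && (#|e| == 2%N).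
Proof. by rewrite inE subsetT => /andP[]. Qed.

Definition dodecahedron : graph dvertex := Graph dodecahedron_eset_pairs.

(* [g] is the permutation of the vertices induced by a rotation about the
   origin, acting on row vectors on the right. *)
Definition is_rotational (g : {perm dvertex}) : Prop :=
  exists A : 'M[R]_3, [/\ A *m A^T = 1%:M, \det A = 1
    & forall v : dvertex, val (g v) = val v *m A].

Definition dodecahedron_rotation_set : {set {perm dvertex}} :=
  [set g : {perm dvertex} | `[< is_rotational g >]].

Lemma dodecahedron_rotation_group_set : group_set dodecahedron_rotation_set.
Proof.
apply/group_setP; split=> [|g h].
  rewrite inE; apply/asboolP; exists 1%:M.
  by split=> [||v]; rewrite ?trmx1 ?mulmx1 ?det1 ?perm1.
rewrite !inE => /asboolP[A [AA dA gA]] /asboolP[B [BB dB hB]].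
apply/asboolP; exists (A *m B); split=> [||v].
- by rewrite trmx_mul mulmxA -(mulmxA A) BB mulmx1.
- by rewrite det_mulmx dA dB mulr1.
- by rewrite permM hB gA mulmxA.
Qed.

Definition dodecahedron_rotations : {group {perm dvertex}} :=
  Group dodecahedron_rotation_group_set.

Definition antipodal_pairs : {set {set dvertex}} :=
  [set [set v; w] | v in [set: dvertex],
                    w in [set w : dvertex | val w == - val v]].

(* In the next two definitions [f] identifies the antipodal quotient with the
   Petersen graph. *)
Definition P_ (f : {set dvertex} -> {set 'I_5}) (a : 'I_5) :
    {set {set dvertex}} :=
  [set e in eset dodecahedron |
    [exists B1 in antipodal_pairs, exists B2 in antipodal_pairs,
      ([set f B1; f B2] \in Q_ a) &&
      [exists x in B1, exists y in B2, e == [set x; y]]]].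

Definition P_family (f : {set dvertex} -> {set 'I_5}) :
    {set {set {set dvertex}}} :=
  [set P_ f a | a : 'I_5].

End Dodecahedron.

(* Main.v *)
Require Import Defs.
From mathcomp Require Import all_boot all_order all_algebra all_fingroup.
From mathcomp Require Import all_solvable boolp reals lra.

Set Implicit Arguments.
Unset Strict Implicit.
Unset Printing Implicit Defensive.

Import Order.TTheory GRing.Theory Num.Theory.
Local Open Scope ring_scope.

(** Label each vertex v of the dodecahedron by the pair f {v, -v} of elements
    of 'I_5.  The two ends of an edge get disjoint labels ([label_edge]), so
    their union misses exactly one element a, and the edge lies in P_a and in no
    other P_b ([P_E], [petersen_missed]).  Hence the P_a are the classes of a
    function from the edges to 'I_5.  By hypothesis every rotation g acts on the
    labels as some s, every s in A_5 arises in this way, and then g maps P_a to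
    P_(s a) ([P_image]).  As A_5 is transitive on 'I_5, the P_a are all nonempty
    and G permutes them transitively.

    It remains to see that each P_a is a matching.  Given v and a, the label of
    a neighbour of v along an edge of P_a must be the complement of a and the
    label of v, so two such neighbours are equal or antipodal.  The second case
    means that {v, w} and {v, -w} are both edges, and [edge_lift_unique] excludes
    it: A_5 is transitive on the arcs of the Petersen graph, by 3-transitivity on
    points, so a rotation would carry this situation to the reference edge
    {base1, base2}, where coordinates rule it out ([base_not_edge]). *)

(** * Two-element sets and permutations induced on a family of sets *)

(** [restr_perm] is the identity unless its argument stabilizes [S]; this is
    where the invariance hypothesis enters. *)
Lemma induced_permE (T : finType) (g : {perm T}) (S : {set {set T}}) :
  {in S, forall B : {set T}, g @: B \in S} ->
  {in S, forall B : {set T}, restr_perm S (actperm ('P^*)%act g) B = g @: B}.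
Proof.
move=> gS B BS; rewrite restr_permE //; first by rewrite actpermE.
rewrite !inE /=; apply/subsetP=> C CS; rewrite inE /= /aperm actpermE.
exact: gS.
Qed.

Lemma set2_eq (T : finType) (a b c d : T) :
  [set a; b] = [set c; d] -> (a = c /\ b = d) \/ (a = d /\ b = c).
Proof.
move=> E; have := set21 a b; have := set22 a b.
have := set21 c d; have := set22 c d; rewrite -{1 2}E {3 4}E !inE.
by do 4!case/orP=> /eqP ?; subst; auto.
Qed.

(** * Arcs of the Petersen graph *)

Lemma petersen_edgeE (v w : {set 'I_5}) :
  ([set v; w] \in eset petersen) =
  [&& #|v| == 2%N, #|w| == 2%N & v :&: w == set0].
Proof.
apply/imset2P/and3P=> [[v' w' v'P]|[v2 w2 vw0]]; last first.
  by exists v w; rewrite ?inE ?v2 ?w2.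
move: v'P; rewrite !inE => v'2 /andP[w'2 vw0].
by case/set2_eq=> [[-> ->]|[-> ->]]; split; rewrite // setIC.
Qed.

(** Two disjoint pairs cover four of the five points. *)
Lemma petersen_missed (v w : {set 'I_5}) :
  [set v; w] \in eset petersen -> exists a, v :|: w = ~: [set a].
Proof.
rewrite petersen_edgeE => /and3P[/eqP v2 /eqP w2 /eqP vw0].
have /eqP/cards1P[a Ea] : #|~: (v :|: w)| = 1%N.
  by rewrite cardsCs setCK card_ord cardsU v2 w2 vw0 cards0.
by exists a; rewrite -Ea setCK.
Qed.

Lemma cover_set2 (T : finType) (v w : {set T}) : cover [set v; w] = v :|: w.
Proof. by rewrite /cover bigcup_setU !big_set1. Qed.

Lemma Q_E a v w :
  ([set v; w] \in Q_ a) =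
  ([set v; w] \in eset petersen) && (a \notin v :|: w).
Proof. by rewrite inE cover_set2. Qed.

Lemma petersen_edge_compl v w a :
  [set v; w] \in eset petersen -> a \notin v :|: w -> w = ~: (a |: v).
Proof.
move=> vw; have [b Eb] := petersen_missed vw; rewrite Eb !inE negbK => /eqP Eab.
move: vw; rewrite petersen_edgeE => /and3P[_ _ /eqP vw0].
apply/setP=> i; move/setP/(_ i): Eb; move/setP/(_ i): vw0.
by rewrite !inE Eab; case: (i \in v); case: (i \in w); case: (i == b).
Qed.

Lemma Alt_transitive (a b : 'I_5) :
  exists2 s : {perm 'I_5}, s \in ('Alt_('I_5))%g & s a = b.
Proof.
have tr := Alt_trans 'I_5; rewrite card_ord /= in tr.
have [s sA ->] := atransP2 (ntransitive1 (ltn0Sn 2) tr) (in_setT a) (in_setT b).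
by exists s.
Qed.

Lemma Alt_3transitive (a b c a' b' c' : 'I_5) :
    uniq [:: a; b; c] -> uniq [:: a'; b'; c'] ->
  exists2 s : {perm 'I_5}, s \in ('Alt_('I_5))%g &
    [/\ s a = a', s b = b' & s c = c'].
Proof.
move=> Ut Ut'; have tr := Alt_trans 'I_5; rewrite card_ord /= in tr.
pose t := [tuple a; b; c]; pose t' := [tuple a'; b'; c'].
have dt : t \in dtuple_on 3 setT by rewrite inE Ut; apply/subsetP=> i _; rewrite inE.
have dt' : t' \in dtuple_on 3 setT by rewrite inE Ut'; apply/subsetP=> i _; rewrite inE.
by have [s sA [-> -> ->]] := atransP2 tr dt dt'; exists s.
Qed.

(** An arc (v, w) amounts to the pair v = {b, c} together with the point a
    missed by the edge, since w is then the complement of {a, b, c}; so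
    3-transitivity on points moves any arc to any other. *)
Lemma petersen_arc_transitive v w v' w' :
    [set v; w] \in eset petersen -> [set v'; w'] \in eset petersen ->
  exists2 s : {perm 'I_5}, s \in ('Alt_('I_5))%g & s @: v = v' /\ s @: w = w'.
Proof.
have arcE u z : [set u; z] \in eset petersen -> exists a b c,
    [/\ uniq [:: a; b; c], u = [set b; c] & z = ~: (a |: [set b; c])].
  move=> uz; have [a Ea] := petersen_missed uz.
  have au : a \notin u :|: z by rewrite Ea !inE eqxx.
  have Ez := petersen_edge_compl uz au.
  move: uz; rewrite petersen_edgeE => /and3P[/cards2P[b [c [bc Eu]]] _ _].
  exists a, b, c; rewrite -Eu; split=> //=; move: au.
  by rewrite Eu !inE !negb_or bc => /andP[/andP[-> ->] _].
move=> /arcE[a [b [c [U -> ->]]]] /arcE[a' [b' [c' [U' -> ->]]]].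
have [s sA [sa sb sc]] := Alt_3transitive U U'; exists s => //.
have sv : s @: [set b; c] = [set b'; c'] by rewrite imsetU !imset_set1 sb sc.
split=> //; rewrite -sv -sa -imset_set1 -imsetU.
apply/setP=> i; rewrite inE -{1 2}[i](permKV s) !mem_imset ?inE //; exact: perm_inj.
Qed.

(** * Antipodal vertices *)

Section Geometry.
Variable R : realType.
Local Notation phi := (golden R).
Implicit Types (v w : dvertex R) (e : {set dvertex R}).

Lemma opp_pt (x y z : R) : - pt x y z = pt (- x) (- y) (- z).
Proof.
by apply/rowP=> i; rewrite !mxE; case: i => [[|[|[|m]]] ?].
Qed.

Lemma mem_pm_opp (a x : R) : (- x \in pm a) = (x \in pm a).
Proof. by rewrite !inE eqr_oppLR eqr_opp orbC. Qed.

Lemma dodecahedron_pointsP (p : 'rV[R]_3) :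
  reflect (exists x y z, p = pt x y z /\
             [\/ [/\ x \in pm 1, y \in pm 1 & z \in pm 1],
                 [/\ x = 0, y \in pm phi^-1 & z \in pm phi],
                 [/\ x \in pm phi^-1, y \in pm phi & z = 0]
               | [/\ x \in pm phi, y = 0 & z \in pm phi^-1]])
          (p \in dodecahedron_points R).
Proof.
apply: (iffP idP).
  rewrite mem_cat => /orP[/allpairsP[[xy z] [/allpairsP[[x y] [? ? ->]] ? ->]]|].
    by exists x, y, z; split=> //; apply: Or41.
  rewrite mem_cat => /orP[/allpairsP[[y z] /= [? ? ->]]|].
    by exists 0, y, z; split=> //; apply: Or42.
  rewrite mem_cat => /orP[/allpairsP[[x y] /= [? ? ->]]|].
    by exists x, y, 0; split=> //; apply: Or43.
  case/allpairsP=> [[x z] /= [? ? ->]].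
  by exists x, 0, z; split=> //; apply: Or44.
case=> x [y [z [-> []]]] [Hx Hy Hz].
- rewrite mem_cat; apply/orP; left; apply/allpairsP; exists ((x, y), z).
  by split=> //; apply/allpairsP; exists (x, y).
- rewrite mem_cat; apply/orP; right; rewrite mem_cat; apply/orP; left.
  by apply/allpairsP; exists (y, z); rewrite Hx.
- rewrite mem_cat; apply/orP; right; rewrite mem_cat; apply/orP; right.
  rewrite mem_cat; apply/orP; left.
  by apply/allpairsP; exists (x, y); rewrite Hz.
- rewrite mem_cat; apply/orP; right; rewrite mem_cat; apply/orP; right.
  rewrite mem_cat; apply/orP; right.
  by apply/allpairsP; exists (x, z); rewrite Hy.
Qed.

Lemma dodecahedron_points_opp (p : 'rV[R]_3) :
  p \in dodecahedron_points R -> - p \in dodecahedron_points R.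
Proof.
case/dodecahedron_pointsP=> x [y [z [-> H]]]; apply/dodecahedron_pointsP.
exists (- x), (- y), (- z); rewrite opp_pt; split=> //; rewrite !mem_pm_opp.
case: H => [] [Hx Hy Hz]; [exact: Or41 | apply: Or42 | apply: Or43 | apply: Or44].
- by rewrite Hx oppr0.
- by rewrite Hz oppr0.
- by rewrite Hy oppr0.
Qed.

Definition antipode v : dvertex R := SeqSub (dodecahedron_points_opp (valP v)).

Definition antipodal_pair v : {set dvertex R} := [set v; antipode v].

Lemma antipodeK : involutive antipode.
Proof. by move=> v; apply: val_inj; rewrite /= opprK. Qed.

Lemma antipodal_pair_antipode v : antipodal_pair (antipode v) = antipodal_pair v.
Proof. by rewrite /antipodal_pair antipodeK setUC. Qed.

Lemma mem_antipodal_pair v w :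
  w \in antipodal_pair v -> antipodal_pair w = antipodal_pair v.
Proof.
by rewrite !inE => /orP[]/eqP-> //; rewrite antipodal_pair_antipode.
Qed.

Lemma antipodal_pair_eq v w :
  antipodal_pair v = antipodal_pair w -> v = w \/ v = antipode w.
Proof.
by move=> E; have := set21 v (antipode v); rewrite -/(antipodal_pair v) E
  !inE => /orP[]/eqP; auto.
Qed.

Lemma antipodal_pairs_imset : antipodal_pairs R = antipodal_pair @: setT.
Proof.
have antiE v w : val w = - val v -> w = antipode v by move=> E; apply: val_inj.
apply/setP=> B; apply/imset2P/imsetP=> [[v w _]|[v _ ->]].
  by rewrite inE => /eqP/antiE-> ->; exists v.
by exists v (antipode v); rewrite ?inE //=.
Qed.

Lemma antipodal_pair_in v : antipodal_pair v \in antipodal_pairs R.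
Proof. by rewrite antipodal_pairs_imset imset_f ?inE. Qed.

(** * Faces and edges *)

Lemma dotN (c p : 'rV[R]_3) : dot c (- p) = - dot c p.
Proof. by rewrite /dot linearN mulmxN mxE. Qed.

Lemma dotNl (c p : 'rV[R]_3) : dot (- c) p = - dot c p.
Proof. by rewrite /dot mulNmx mxE. Qed.

Lemma dot_ptE (a b c x y z : R) : dot (pt a b c) (pt x y z) = a * x + b * y + c * z.
Proof. by rewrite /dot !mxE !big_ord_recl big_ord0 !mxE /= addr0 addrA. Qed.

Lemma ptE (c : 'rV[R]_3) : c = pt (c 0 0) (c 0 1) (c 0 2%:R).
Proof.
by apply/rowP=> i; rewrite !mxE; case: i => [[|[|[|m]]] ?] //=;
  congr (c 0 _); apply: val_inj.
Qed.

Lemma face_antipode e : is_face e -> is_face (antipode @: e).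
Proof.
move=> [c [d H]]; exists (- c), d => v; have [le_d onF] := H (antipode v).
rewrite dotNl -dotN; split=> //; rewrite -onF.
by rewrite -{1}[v]antipodeK mem_imset //; apply: inv_inj antipodeK.
Qed.

(** The functional takes opposite values at antipodal vertices, so if its
    maximum is not positive it vanishes at all of them. *)
Lemma face_gt0 e (c : 'rV[R]_3) d :
    (forall v, dot c (val v) <= d /\ (v \in e <-> dot c (val v) = d)) ->
  e != setT -> 0 < d.
Proof.
move=> H; apply: contraNT; rewrite -leNgt => d_le0; apply/eqP/setP=> v; rewrite inE.
have [Hv onF] := H v; have [Hv' _] := H (antipode v).
by apply/onF; move: Hv'; rewrite /= dotN; lra.
Qed.

Lemma edgeP e : reflect (#|e| = 2%N /\ is_face e) (e \in eset (dodecahedron R)).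
Proof.
rewrite inE; apply: (iffP andP) => [[/eqP-> /asboolP]|[-> eF]] //.
by split=> //; apply/asboolP.
Qed.

Lemma edge_antipode v w :
  ([set antipode v; antipode w] \in eset (dodecahedron R)) =
  ([set v; w] \in eset (dodecahedron R)).
Proof.
have imp v' w' : [set v'; w'] \in eset (dodecahedron R) ->
    [set antipode v'; antipode w'] \in eset (dodecahedron R).
  move=> /edgeP[c2 F]; apply/edgeP; rewrite -!imset_set1 -imsetU.
  by split; [rewrite card_imset //; apply: inv_inj antipodeK|apply: face_antipode].
by apply/idP/idP=> [/imp|/imp//]; rewrite !antipodeK.
Qed.

(** * Rotations *)

Local Notation rotations := (dodecahedron_rotations R).

Lemma rotation_antipode g v : g \in rotations -> g (antipode v) = antipode (g v).
Proof.
rewrite inE => /asboolP[A [_ _ gA]]; apply: val_inj.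
by rewrite gA /= gA mulNmx.
Qed.

Lemma rotation_antipodal_pair g v :
  g \in rotations -> g @: antipodal_pair v = antipodal_pair (g v).
Proof. by move=> gG; rewrite imsetU !imset_set1 rotation_antipode. Qed.

(** If F is exposed by the functional c, then its image under the orthogonal
    matrix A is exposed by c A, with the same maximum. *)
Lemma rotation_face g e : g \in rotations -> is_face e -> is_face (g @: e).
Proof.
rewrite inE => /asboolP[A [AA _ gA]] [c [d H]]; exists (c *m A), d => v.
have [le_d onF] := H (g^-1%g v); rewrite -[v](permKV g) mem_imset; last exact: perm_inj.
by rewrite gA /dot trmx_mul !mulmxA -(mulmxA c) AA mulmx1.
Qed.

Lemma rotation_edges g :
  g \in rotations -> edges_image g (eset (dodecahedron R)) = eset (dodecahedron R).
Proof.
move=> gG; apply/eqP; rewrite eqEcard; apply/andP; split.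
  apply/subsetP=> _ /imsetP[e /edgeP[c2 eF] ->]; apply/edgeP.
  by rewrite card_imset; [split=> //; apply: rotation_face|apply: perm_inj].
by rewrite card_imset //; apply: imset_inj; apply: perm_inj.
Qed.

Lemma rotation_edge g v w : g \in rotations ->
  ([set g v; g w] \in eset (dodecahedron R)) = ([set v; w] \in eset (dodecahedron R)).
Proof.
move=> gG; rewrite -{1}(rotation_edges gG) -!imset_set1 -imsetU mem_imset //.
by apply: imset_inj; apply: perm_inj.
Qed.

Lemma rotation_auts : rotations \subset graph_auts (dodecahedron R).
Proof.
apply/subsetP=> g gG; rewrite inE rotation_edges // eqxx andbT.
by apply/subsetP=> x; rewrite !inE.
Qed.

(** * A reference edge *)

Lemma golden_gt1 : 1 < phi.
Proof.
have : Num.sqrt 1 < Num.sqrt (5 : R) by rewrite ltr_sqrt; lra.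
by rewrite sqrtr1 /golden => ?; lra.
Qed.

Lemma goldenV_bounds : 0 < phi^-1 /\ phi^-1 < 1.
Proof. by have := golden_gt1; split; rewrite ?invf_lt1 ?invr_gt0; lra. Qed.

Lemma mem_base (s : R) : s \in pm phi^-1 -> pt phi 0 s \in dodecahedron_points R.
Proof.
move=> sP; apply/dodecahedron_pointsP; exists phi, 0, s; split=> //.
by apply: Or44; rewrite mem_head.
Qed.

Lemma mem_top (s : R) : s \in pm phi^-1 -> pt 0 s phi \in dodecahedron_points R.
Proof.
move=> sP; apply/dodecahedron_pointsP; exists 0, s, phi; split=> //.
by apply: Or42; rewrite mem_head.
Qed.

(** The reference edge joins (phi, 0, 1/phi) to (phi, 0, -1/phi). *)
Definition base1 : dvertex R := SeqSub (mem_base (mem_head _ _)).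
Definition base2 : dvertex R := SeqSub (mem_base (mem_last _ [:: - phi^-1])).

Lemma base_neq : base1 != base2.
Proof.
have [? ?] := goldenV_bounds.
by apply/eqP=> /(congr1 val) /rowP/(_ 2%:R); rewrite !mxE /=; lra.
Qed.

Lemma base_neq_antipode : base1 != antipode base2.
Proof.
have ? := golden_gt1.
by apply/eqP=> /(congr1 val) /rowP/(_ 0); rewrite !mxE /=; lra.
Qed.

Lemma base2_neq_antipode : base2 != antipode base2.
Proof.
have ? := golden_gt1.
by apply/eqP=> /(congr1 val) /rowP/(_ 0); rewrite !mxE /=; lra.
Qed.

(** It is exposed by the first coordinate, whose maximum is phi. *)
Lemma base_edge : [set base1; base2] \in eset (dodecahedron R).
Proof.
apply/edgeP; split; first by rewrite cards2 base_neq.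
exists (pt 1 0 0), phi => v.
have ? := golden_gt1; have [? ?] := goldenV_bounds.
have [x [y [z [Ev Hv]]]] := dodecahedron_pointsP _ (valP v).
have [x_le Hx] : x <= phi /\ (x = phi -> y = 0 /\ z \in pm phi^-1).
  case: Hv => [] []; rewrite !inE.
  - by move=> /orP[]/eqP-> _ _; split; lra.
  - by move=> -> _ _; split; lra.
  - by move=> /orP[]/eqP-> _ _; split; lra.
  - by move=> /orP[]/eqP-> -> ?; split=> //; lra.
have -> : (v \in [set base1; base2]) =
          (pt x y z == pt phi 0 phi^-1) || (pt x y z == pt phi 0 (- phi^-1)).
  by rewrite -Ev !inE.
rewrite Ev dot_ptE !mul0r !addr0 mul1r; split=> //; split.
  by case/orP=> /eqP/rowP/(_ 0); rewrite !mxE.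
move=> /[dup]/Hx[-> +] ->; rewrite !inE.
by case/orP=> /eqP->; rewrite eqxx ?orbT.
Qed.

Lemma edge_neq_setT e : e \in eset (dodecahedron R) -> e != setT.
Proof.
case/edgeP=> e2 _; apply: contra_eq_neq e2 => ->.
have s3 : #|antipode base2 |: [set base1; base2]| = 3%N.
  by rewrite cardsU1 cards2 !inE negb_or base_neq !(eq_sym (antipode _))
    base_neq_antipode base2_neq_antipode.
by rewrite neq_ltn -s3 subset_leq_card ?orbT.
Qed.

(** An exposing functional would have maximum zero, against [face_gt0]. *)
Lemma edge_not_antipodal v : [set v; antipode v] \notin eset (dodecahedron R).
Proof.
apply/negP=> /[dup] /edge_neq_setT eT /edgeP[_ [c [d H]]].
have d_gt0 := face_gt0 H eT.
have [_ [/(_ (set21 _ _)) Ex _]] := H v.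
have [_ [/(_ (set22 _ _)) + _]] := H (antipode v); rewrite /= dotN; lra.
Qed.

(** The midpoint (0, 0, 1/phi) of this pair is a shrunk copy of the midpoint
    (0, 0, phi) of the vertices (0, 1/phi, phi) and (0, -1/phi, phi), so a
    functional with positive maximum d cannot attain d at both of its ends. *)
Lemma base_not_edge : [set base1; antipode base2] \notin eset (dodecahedron R).
Proof.
apply/negP=> /[dup] /edge_neq_setT eT /edgeP[_ [c [d H]]].
have d_gt0 := face_gt0 H eT.
have [_ [/(_ (set21 _ _)) E1 _]] := H base1.
have [_ [/(_ (set22 _ _)) E2 _]] := H (antipode base2).
have [E3 _] := H (SeqSub (mem_top (mem_head _ _)));
  have [E4 _] := H (SeqSub (mem_top (mem_last _ [:: - phi^-1]))).
move: E1 E2 E3 E4; rewrite (ptE c) /= dotN !dot_ptE; move: (c 0 0) (c 0 1) (c 0 2%:R).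
have ? := golden_gt1; have [? ?] := goldenV_bounds => c0 c1 c2 E1 E2 E3 E4.
have E5 : c2 * phi^-1 = d by lra.
have E6 : c2 * phi <= d by lra.
(* Hence 0 < c2 and c2 * phi <= c2 / phi, against 1 / phi < 1 < phi. *)
have c2_gt0 : 0 < c2 by rewrite -(pmulr_lgt0 _ (proj1 goldenV_bounds)) E5.
nra.
Qed.

End Geometry.

(** * The decomposition *)

Section Decomposition.
Variables (R : realType) (f : {set dvertex R} -> {set 'I_5}).
Hypothesis f_iso :
  graph_iso (quotient_graph (dodecahedron R) (antipodal_pairs R)) petersen f.
Hypothesis f_carries :
  carries_perms f (antipodal_pairs R)
    (induced_perms (dodecahedron_rotations R) (antipodal_pairs R)) petersen_A5.

Local Notation Gamma := (dodecahedron R).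
Local Notation G := (dodecahedron_rotations R).
Implicit Types (v w x y : dvertex R) (a : 'I_5) (g : {perm dvertex R})
  (s : {perm 'I_5}).

Definition label v : {set 'I_5} := f (antipodal_pair v).

Lemma label_card v : #|label v| = 2%N.
Proof.
case: f_iso => _ im_f _; have : label v \in vset petersen.
  by rewrite -im_f; apply: imset_f; apply: antipodal_pair_in.
by rewrite inE => /eqP.
Qed.

Lemma label_inj v w : label v = label w -> v = w \/ v = antipode w.
Proof.
case: f_iso => inj_f _ _ E; apply: antipodal_pair_eq.
by apply: inj_f E => /=; apply: antipodal_pair_in.
Qed.

(** The quotient edge needs its two ends distinct: an edge of the polytope never
    joins antipodal vertices. *)
Lemma label_edge v w :
  [set v; w] \in eset Gamma -> [set label v; label w] \in eset petersen.
Proof.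
move=> vw; case: f_iso => _ _ ->; rewrite ?antipodal_pair_in //=.
apply/imset2P; exists (antipodal_pair v) (antipodal_pair w) => //.
  exact: antipodal_pair_in.
rewrite inE antipodal_pair_in /=; apply/andP; split; last first.
  apply/existsP; exists v; rewrite set21; apply/existsP; exists w.
  by rewrite set21.
apply: contraTneq vw => /esym/antipodal_pair_eq[->|->]; last first.
  exact: edge_not_antipodal.
by apply/negP=> /edgeP[]; rewrite cards2 eqxx.
Qed.

(** The vertices of an edge determine their antipodal pairs, so the existential
    quantifiers in the definition of [P_] leave no choice except the order. *)
Lemma P_E a v w :
  ([set v; w] \in P_ f a) =
  ([set v; w] \in eset Gamma) && (a \notin label v :|: label w).
Proof.
rewrite inE; case vw: (_ \in eset Gamma) => //=.
have lvw := label_edge vw.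
apply/existsP/idP=> [[B1 /andP[B1P /existsP[B2 /and3P[B2P]]]]|a_vw].
  rewrite Q_E => /andP[_ a_vw] /existsP[x /andP[xB1 /existsP[y /andP[yB2]]]].
  move: B1P B2P; rewrite antipodal_pairs_imset.
  move=> /imsetP[v1 _ E1] /imsetP[w1 _ E2]; rewrite E1 in xB1 a_vw.
  rewrite E2 in yB2 a_vw.
  move: a_vw; rewrite -(mem_antipodal_pair xB1) -(mem_antipodal_pair yB2).
  by move=> a_vw /eqP/set2_eq[[-> ->]|[-> ->]] //; rewrite setUC.
exists (antipodal_pair v); rewrite antipodal_pair_in; apply/existsP.
exists (antipodal_pair w); rewrite antipodal_pair_in Q_E -/(label v) -/(label w).
rewrite lvw a_vw; apply/existsP; exists v; rewrite set21; apply/existsP.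
by exists w; rewrite set21 eqxx.
Qed.

Lemma P_edges a e : e \in P_ f a -> e \in eset Gamma.
Proof. by rewrite inE => /andP[]. Qed.

Lemma edge_set2 e : e \in eset Gamma -> exists v w, e = [set v; w].
Proof.
by case/edgeP=> /eqP/cards2P[v [w [_ ->]]] _; exists v, w.
Qed.

Lemma edge_at e v : e \in eset Gamma -> v \in e -> exists w, e = [set v; w].
Proof.
case/edge_set2=> x [y ->]; rewrite !inE => /orP[]/eqP->; first by exists y.
by exists x; rewrite setUC.
Qed.

Lemma P_eq a b e : e \in P_ f a -> e \in P_ f b -> a = b.
Proof.
move=> ea; have [v [w Ee]] := edge_set2 (P_edges ea); move: ea.
rewrite Ee !P_E => /andP[vw]; rewrite vw /=.
have [c ->] := petersen_missed (label_edge vw).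
by rewrite !inE !negbK => /eqP-> /eqP->.
Qed.

Lemma P_cover e : e \in eset Gamma -> exists a, e \in P_ f a.
Proof.
move=> eE; have [v [w Ee]] := edge_set2 eE; rewrite Ee in eE *.
have [a Ea] := petersen_missed (label_edge eE); exists a.
by rewrite P_E eE Ea !inE eqxx.
Qed.

(** g acts on the labels, that is on antipodal pairs seen through [f], as s does
    on pairs of points. *)
Definition intertwined g s := forall v, label (g v) = s @: label v.

Lemma rotation_induced g v : g \in G ->
  restr_perm (antipodal_pairs R) (actperm ('P^*)%act g) (antipodal_pair v)
  = antipodal_pair (g v).
Proof.
move=> gG; rewrite induced_permE ?antipodal_pair_in ?rotation_antipodal_pair //.
move=> B; rewrite antipodal_pairs_imset => /imsetP[w _ ->].
by rewrite rotation_antipodal_pair // imset_f.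
Qed.

Lemma Alt_induced s (p : {set 'I_5}) : #|p| = 2%N ->
  restr_perm petersen_vset (actperm ('P^*)%act s) p = s @: p.
Proof.
move=> p2; rewrite induced_permE ?inE ?p2 // => B.
by rewrite !inE card_imset //; apply: perm_inj.
Qed.

Lemma rotation_intertwined g : g \in G -> exists s, intertwined g s.
Proof.
case: f_carries => GA _ gG; case: (GA _ (imset_f _ gG)) => _ /imsetP[s _ ->] H.
exists s => v; have := H _ (antipodal_pair_in v).
by rewrite rotation_induced // Alt_induced // label_card.
Qed.

Lemma Alt_intertwined s : s \in ('Alt_('I_5))%g ->
  exists2 g, g \in G & intertwined g s.
Proof.
case: f_carries => _ AG sA; case: (AG _ (imset_f _ sA)) => _ /imsetP[g gG ->] H.
exists g => // v; have := H _ (antipodal_pair_in v).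
by rewrite rotation_induced // Alt_induced // label_card.
Qed.

(** An edge e is in P_a when a is outside the labels of its ends; moving e by g
    moves these labels by s. *)
Lemma P_image g s a :
  g \in G -> intertwined g s -> edges_image g (P_ f a) = P_ f (s a).
Proof.
move=> gG gs.
have P_g v w : ([set g v; g w] \in P_ f (s a)) = ([set v; w] \in P_ f a).
  rewrite !P_E rotation_edge // !gs -imsetU mem_imset //; exact: perm_inj.
have im_g v w : g @: [set v; w] = [set g v; g w].
  by rewrite imsetU !imset_set1.
apply/setP=> e; apply/imsetP/idP=> [[e' ea ->]|es].
  have [v [w Ee]] := edge_set2 (P_edges ea).
  by rewrite Ee im_g P_g -Ee.
have := P_edges es; rewrite -(rotation_edges gG) => /imsetP[e' e'E Ee].
have [v [w Ee']] := edge_set2 e'E.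
by exists e' => //; rewrite Ee' -P_g -im_g -Ee' -Ee.
Qed.

(** Some P_b contains the reference edge, and A_5 moves b to a. *)
Lemma P_neq0 a : P_ f a != set0.
Proof.
have [b bE] := P_cover (base_edge R).
have [s sA <-] := Alt_transitive b a; have [g gG gs] := Alt_intertwined sA.
apply/set0Pn; exists (g @: [set base1 R; base2 R]).
by rewrite -(P_image b gG gs) imset_f.
Qed.

Lemma P_partition : partition (P_family f) (eset Gamma).
Proof.
apply/and3P; split.
- apply/eqP/setP=> e; apply/bigcupP/idP=> [[_ /imsetP[a _ ->]]|].
    exact: P_edges.
  by case/P_cover=> a ea; exists (P_ f a) => //; apply: imset_f.
- apply/trivIsetP=> _ _ /imsetP[a _ ->] /imsetP[b _ ->].
  apply: contraNT; rewrite -setI_eq0 => /set0Pn[e /setIP[ea eb]].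
  by rewrite (P_eq ea eb).
- by apply/imsetP=> [[a _ /esym/eqP]]; rewrite (negbTE (P_neq0 a)).
Qed.

(** Of the two lifts {v, w} and {v, -w} of an edge of the quotient, at most one
    is an edge of the polytope.  Arc-transitivity moves the pair to the reference
    edge, up to replacing either end by its antipode. *)
Lemma edge_lift_unique v w :
  [set v; w] \in eset Gamma -> [set v; antipode w] \notin eset Gamma.
Proof.
move=> vw; apply/negP=> vw'.
have [s sA [sv sw]] :=
  petersen_arc_transitive (label_edge vw) (label_edge (base_edge R)).
have [g gG gs] := Alt_intertwined sA.
have /label_inj Ev : label (g v) = label (base1 R) by rewrite gs.
have /label_inj Ew : label (g w) = label (base2 R) by rewrite gs.
have nE := base_not_edge R.
have nE' : [set antipode (base1 R); base2 R] \notin eset Gamma.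
  by rewrite -edge_antipode antipodeK.
move: vw vw'; rewrite -(rotation_edge v w gG) -(rotation_edge v _ gG).
rewrite rotation_antipode //.
case: Ev => ->; case: Ew => ->; rewrite ?antipodeK.
- by rewrite (negbTE nE).
- by rewrite (negbTE nE).
- by rewrite (negbTE nE').
- by rewrite (negbTE nE').
Qed.

Lemma P_matching a : {in cover (P_ f a), forall v, valency (P_ f a) v = 1%N}.
Proof.
move=> v /bigcupP[e ea ve]; have [w Ee] := edge_at (P_edges ea) ve.
apply/eqP/cards1P; exists e; apply/setP=> e'; rewrite inE in_set1.
apply/andP/eqP=> [[e'a ve']|->] //; have [w' Ee'] := edge_at (P_edges e'a) ve'.
move: ea e'a; rewrite Ee Ee' !P_E => /andP[vw aw] /andP[vw' aw'].
have Ew : label w' = label w.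
  rewrite (petersen_edge_compl (label_edge vw) aw).
  exact: petersen_edge_compl (label_edge vw') aw'.
case: (label_inj Ew) vw' => [-> //|->].
by rewrite (negbTE (edge_lift_unique vw)).
Qed.

End Decomposition.

Theorem mainTheorem3 (R : realType) (f : {set dvertex R} -> {set 'I_5})
    (f_iso : graph_iso
               (quotient_graph (dodecahedron R) (antipodal_pairs R)) petersen f)
    (f_carries : carries_perms f (antipodal_pairs R)
                   (induced_perms (dodecahedron_rotations R)
                      (antipodal_pairs R))
                   petersen_A5) :
  transitive_1_decomposition
    (dodecahedron R) (dodecahedron_rotations R) (P_family f).
Proof.
split; last by move=> _ /imsetP[a _ ->]; apply: P_matching.
split; [exact: rotation_auts|exact: P_partition| |].
  move=> _ g /imsetP[a _ ->] gG.
  have [s gs] := rotation_intertwined f_iso f_carries gG.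
  by rewrite (P_image f_iso a gG gs) imset_f.
move=> _ _ /imsetP[a _ ->] /imsetP[b _ ->].
have [s sA <-] := Alt_transitive a b.
have [g gG gs] := Alt_intertwined f_iso f_carries sA.
by exists g => //; apply: P_image.
Qed.
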